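(* For every oriented graph $D$ that is a core and every positive integer $\ell$, there is an oriented graph $D^*$ of girth at least $\ell$ that is uniquely $D$-colourable.
   Context: An oriented graph $D$ is a digraph with vertex set $V(D)$ and arc set $A(D)$ such that for every pair of vertices $u,v$ at most one of $uv$ and $vu$ is in $A(D)$; oriented graphs are always finite and loopless, without multiple arcs. Cycles are directed cycles, and the girth of an oriented graph is the length of a shortest directed cycle in it (with the convention that the girth is infinite if there is no directed cycle). For oriented graphs $D$ and $C$, a homomorphism from $D$ to $C$ is a map $f\colon V(D)\to V(C)$ such that $xy\in A(D)$ implies $f(x)f(y)\in A(C)$; such a homomorphism is also called a $C$-colouring of $D$. An oriented graph $D$ is a core if every homomorphism $f\colon V(D)\to V(D)$ from $D$ to itself is an automorphism of $D$. An oriented graph $D$ is uniquely $C$-colourable if there is a homomorphism of $D$ onto $C$ (surjective on vertices), and for any two $C$-colourings $\psi$ and $\varphi$ of $D$ there is some automorphism $f\in\mathrm{Aut}(C)$ such that $\psi=f\circ\varphi$. *)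

(* Defs.v *)
From mathcomp Require Import all_boot.

Set Implicit Arguments.
Unset Strict Implicit.
Unset Printing Implicit Defensive.

Record oriented_graph := OrientedGraph {
  vertex :> finType;
  arc : rel vertex;
  arc_irr : irreflexive arc;
  arc_asym : forall u v : vertex, ~~ (arc u v && arc v u)
}.

(* [:: v_1; ...; v_n] stands for the directed cycle v_1 -> ... -> v_n -> v_1;
   [ucycleb] holds of the empty sequence, which has to be excluded. *)
Definition dicycle (D : oriented_graph) (c : seq D) : bool :=
  (c != [::]) && ucycleb (@arc D) c.

Definition has_dicycle (D : oriented_graph) (n : nat) : bool :=
  [exists c : n.-tuple D, dicycle c].

(* [None] is infinity. Since the vertices of a cycle are distinct, only the
   lengths 1, ..., #|D| can occur. *)
Definition girth (D : oriented_graph) : option nat :=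
  ohead [seq n <- iota 1 #|D| | has_dicycle D n].

Definition girth_geq (D : oriented_graph) (l : nat) : bool :=
  if girth D is Some g then l <= g else true.

Definition is_hom (D C : oriented_graph) (f : D -> C) : Prop :=
  forall x y : D, arc x y -> arc (f x) (f y).

Definition is_aut (D : oriented_graph) (f : D -> D) : Prop :=
  bijective f /\ (forall x y : D, arc (f x) (f y) = arc x y).

Definition is_core (D : oriented_graph) : Prop :=
  forall f : D -> D, is_hom f -> is_aut f.

Definition uniquely_colourable (D C : oriented_graph) : Prop :=
  (exists f : D -> C, is_hom f /\ (forall y : C, exists x : D, f x = y)) /\
  (forall psi phi : D -> C, is_hom psi -> is_hom phi ->
     exists2 f : C -> C, is_aut f & psi =1 f \o phi).

Lemma girth_geqP (D : oriented_graph) (l : nat) :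
  reflect (forall c : seq D, dicycle c -> l <= size c) (girth_geq D l).
Proof.
have mem n : (n \in [seq n <- iota 1 #|D| | has_dicycle D n]) = has_dicycle D n.
  rewrite mem_filter mem_iota; apply: andb_idr => /existsP[c].
  case/andP => c0 /andP[_ /card_uniqP cu].
  by rewrite add1n ltnS -{2}(size_tuple c) -cu max_card andbT
             -(size_tuple c) lt0n size_eq0.
have hasP (c : seq D) : dicycle c -> has_dicycle D (size c).
  by move=> dc; apply/existsP; exists (in_tuple c).
have srt : sorted leq [seq n <- iota 1 #|D| | has_dicycle D n].
  exact: (sorted_filter leq_trans) (iota_sorted 1 #|D|).
rewrite /girth_geq /girth.
case E : [seq n <- _ | _] mem srt => [|g s] mem srt /=.
  by apply: ReflectT => c /hasP; rewrite -mem.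
apply: (iffP idP) => [lg c /hasP | H].
  rewrite -mem inE => /predU1P[-> //|cs]; apply: leq_trans lg _.
  by have /allP/(_ _ cs) := order_path_min leq_trans srt.
have /existsP[c /H] : has_dicycle D g by rewrite -mem mem_head.
by rewrite size_tuple.
Qed.

(* Main.v *)
Require Import Defs.
From mathcomp Require Import all_boot zify.
(* [arc] is the arc relation again, not the segment of a cyclic sequence. *)
Import Defs.

Set Implicit Arguments.
Unset Strict Implicit.
Unset Printing Implicit Defensive.

(** Only directed cycles have to be long, so an explicit graph does the job:
    the product of [D] with a circulant digraph on the integers modulo [M],
    in which every [i] points to [i + 1], ..., [i + N].  A directed cycle of
    the product projects to a closed walk of the circulant, which winds around
    the [M] positions with steps of size at most [N], hence has length at least
    [M / N].  Taking [M] large makes the girth large ([closed_walk_long]).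

    The first projection maps the product onto [D].  Conversely, a colouring of
    the product by [D] is a periodic sequence of maps [F 0], [F 1], ... from
    [D] to [D] such that [x -> y] implies [F a x -> F b y] whenever
    [a < b <= a + N].  When [D] is a core, two facts force this sequence to
    be a constant endomorphism:
    - by the pigeonhole principle any long enough window contains two equal
      maps, and a map that occurs twice within [N] steps is an endomorphism
      ([window_hom]);
    - two endomorphisms within [N] steps of each other are equal
      ([linked_hom_eq]), and a map squeezed between two occurrences of the same
      endomorphism is equal to that endomorphism ([linked_eq]).
    When [N] is twice the length of the window, every map of the sequence is
    squeezed in this way, so every colouring is an automorphism of [D] composed
    with the projection.  Two such colourings differ by an automorphism. *)

(** * Rigidity of cores *)

(** The relation between the fibre maps of a colouring of a product
    over two adjacent positions; [linked f f] is [is_hom f]. *)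
Definition linked {D : oriented_graph} (f g : D -> D) : Prop :=
  forall x y : D, arc x y -> arc (f x) (g y).

Section Core.

Variable D : oriented_graph.
Hypothesis coreD : is_core D.

Lemma core_hom_inv (g : D -> D) :
  is_hom g -> exists k : D -> D, [/\ cancel g k, cancel k g & is_hom k].
Proof.
move=> /coreD[[k gK kK] gE]; exists k; split=> // x y.
by rewrite -[arc (k x) _]gE !kK.
Qed.

(** Under these hypotheses [h v] has all the in- and out-neighbours of [v], so
    moving [v] alone onto [h v] is an endomorphism, which is injective
    only if [h v = v]. *)
Lemma core_fold_id (h : D -> D) : linked h id -> linked id h -> h =1 id.
Proof.
move=> h_id id_h v; pose f x := if x == v then h v else x.
have /coreD[/bij_inj f_inj _] : is_hom f.
  move=> x y xy; rewrite /f.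
  have [xv|_] := eqVneq x v; have [yv|_] := eqVneq y v => //.
  - by move: xy; rewrite xv yv arc_irr.
  - by apply: h_id; rewrite -xv.
  - by apply: id_h; rewrite -yv.
by apply: f_inj; rewrite /f eqxx; case: ifP.
Qed.

Lemma linked_eq (g f : D -> D) :
  is_hom g -> linked g f -> linked f g -> f =1 g.
Proof.
move=> /core_hom_inv[k [gK kK kP]] gf fg x.
suff kf_id : k \o f =1 id by rewrite -[LHS]kK -[k _]/((k \o f) x) kf_id.
by apply: core_fold_id => u v uv /=; [rewrite -[v]gK | rewrite -[u]gK];
  apply: kP; [apply: fg | apply: gf].
Qed.

(** Up to an automorphism the first map is the identity and the second one an
    automorphism [h] such that [x -> y] implies [x -> h y].  Iterating, [x -> y]
    implies [h x -> h^n y] for all [n > 0]; since [h] permutes a finite set,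
    some such [h^n] fixes [y], and [h] is also linked to the identity. *)
Lemma linked_hom_eq (g g' : D -> D) :
  is_hom g -> is_hom g' -> linked g g' -> g' =1 g.
Proof.
move=> gP g'P gg'; have [k [gK kK kP]] := core_hom_inv gP.
pose h := k \o g'.
have hP : is_hom h by move=> x y /g'P/kP.
have id_h : linked id h by move=> x y /gg'/kP; rewrite gK.
have h_inj : injective h by have [/bij_inj] := coreD hP.
have iter_h n x y : arc x y -> arc x (iter n h y).
  by move=> xy; elim: n => //= n /id_h.
have h_id : linked h id.
  move=> x y /hP/(iter_h (order h y).-1).
  by rewrite -iterSr prednK ?order_gt0// iter_order.
by move=> x; rewrite -[LHS]kK -[k _]/(h x) (core_fold_id h_id id_h).
Qed.

(** * Sequences of maps that are linked at short distance *)

Section Sequence.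

Let W : nat := #|{ffun D -> D}|.
Variable F : nat -> D -> D.
Hypothesis linkF : forall a b, a < b <= a + W.*2 -> linked (F a) (F b).

Lemma window_hom (a : nat) : exists2 i, a <= i < a + W & is_hom (F i).
Proof.
pose G (i : 'I_W.+1) : {ffun D -> D} := finfun (F (a + i)).
have /injectivePn[i [j neq_ij eqG]] : ~~ injectiveb G.
  by apply/injectiveP => /leq_card; rewrite card_ord ltnn.
have {eqG} eqF x : F (a + i) x = F (a + j) x.
  by have /ffunP/(_ x) := eqG; rewrite !ffunE.
wlog lt_ij : i j neq_ij eqF / i < j.
  move=> th; have [lt_ij|lt_ji|/val_inj eq_ij] := ltngtP i j.
  - exact: th neq_ij eqF lt_ij.
  - by apply: (th j i) => //; rewrite eq_sym.
  - by rewrite eq_ij eqxx in neq_ij.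
have ltj := ltn_ord j; exists (a + i); first by lia.
by move=> x y xy; rewrite [X in arc _ X]eqF; apply: linkF xy; lia.
Qed.

(** [F k] lies between an endomorphism of the window before [k] and one of the
    window after [k].  These two are at distance at most [2W], so they are
    linked and hence equal. *)
Lemma hom_after_window (k : nat) : W <= k -> is_hom (F k).
Proof.
move=> leWk.
have [i i_k Fi] := window_hom (k - W); have [j j_k Fj] := window_hom k.+1.
have eq_ji : F j =1 F i by apply: linked_hom_eq => //; apply: linkF; lia.
have ik : linked (F i) (F k) by apply: linkF; lia.
have ki : linked (F k) (F i).
  by move=> x y xy; rewrite -eq_ji; apply: linkF xy; lia.
by move=> x y xy; rewrite !(linked_eq Fi ik ki); apply: Fi.
Qed.

Lemma constant_after_window (n : nat) : F (W + n) =1 F W.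
Proof.
have W_gt0 : 0 < W by apply/card_gt0P; exists (finfun id).
elim: n => [|n IHn] x; first by rewrite addn0.
rewrite -IHn; apply: linked_hom_eq; try (apply: hom_after_window; lia).
by apply: linkF; lia.
Qed.

End Sequence.

End Core.

(** * Products with circulants *)

Definition circulant (m N : nat) : rel 'I_m.+1 :=
  fun i j => [exists d : 'I_N, j == i + d.+1 %[mod m.+1]].

Arguments circulant : clear implicits.

Lemma circulant_path (m N : nat) (i : 'I_m.+1) (p : seq 'I_m.+1) :
  path (circulant m N) i p ->
  exists2 s, size p <= s <= N * size p & last i p = i + s %[mod m.+1].
Proof.
elim: p i => [|j p IHp] i /=; first by exists 0; rewrite ?addn0 ?muln0.
case/andP=> /existsP[d /eqP ij] /IHp[s s_p ->].
have ltd := ltn_ord d; exists (d.+1 + s); first by rewrite mulnS; lia.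
by rewrite addnA -[LHS]modnDml ij modnDml.
Qed.

(** The steps of a closed walk add up to a positive multiple of the modulus. *)
Lemma closed_walk_long (m N : nat) (c : seq 'I_m.+1) :
  c != [::] -> cycle (circulant m N) c -> m < N * size c.
Proof.
case: c => // i p _ /= /circulant_path[s]; rewrite last_rcons size_rcons /=.
case/andP=> s_gt0 leS /eqP; rewrite -{1}[i : nat]addn0 eqn_modDl mod0n eq_sym.
move=> dvd_s; apply: leq_trans leS; apply: dvdn_leq dvd_s.
exact: leq_trans s_gt0.
Qed.

Section Tensor.

Variables (D : oriented_graph) (T : finType) (r : rel T).

Definition tensor_arc : rel (D * T) :=
  fun u v => arc u.1 v.1 && r u.2 v.2.

Lemma tensor_irr : irreflexive tensor_arc.
Proof. by move=> u; rewrite /tensor_arc arc_irr. Qed.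

Lemma tensor_asym (u v : D * T) : ~~ (tensor_arc u v && tensor_arc v u).
Proof.
apply/negP => /andP[/andP[uv _] /andP[vu _]].
by have /negP[] := arc_asym u.1 v.1; rewrite uv.
Qed.

Definition tensor : oriented_graph := OrientedGraph tensor_irr tensor_asym.

End Tensor.

Lemma girth_tensor_circulant (D : oriented_graph) (m N l : nat) :
  N * l <= m.+1 -> girth_geq (tensor D (circulant m N)) l.
Proof.
move=> leM; apply/girth_geqP => c /andP[c0 /andP[cyc _]].
have : m < N * size (map snd c).
  apply: closed_walk_long; first by case: (c) c0.
  by rewrite cycle_map; apply: sub_cycle cyc => u v /andP[].
rewrite size_map => lt_m; have := leq_trans leM lt_m.
by rewrite leq_mul2l; case: (N) lt_m.
Qed.

(** Position [n] of the circulant is unfolded to all naturals congruent to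
    [n]: the fibre maps of a colouring then form a sequence to which
    [constant_after_window] applies, and every fibre occurs after the first
    window. *)
Lemma tensor_circulant_hom (D : oriented_graph) (m : nat)
    (phi : tensor D (circulant m #|{ffun D -> D}|.*2) -> D) :
  is_core D -> is_hom phi ->
  exists2 g : D -> D, is_hom g & forall u, phi u = g u.1.
Proof.
set W := #|_| in phi *; move=> coreD phiP.
pose pos n : 'I_m.+1 := inord (n %% m.+1).
have posE n : pos n = n %% m.+1 :> nat by rewrite inordK ?ltn_mod.
pose F n (x : D) := phi (x, pos n).
have linkF a b : a < b <= a + W.*2 -> linked (F a) (F b).
  move=> ab x y xy; apply: phiP; rewrite /= /tensor_arc /= xy /=.
  have ltd : (b - a).-1 < W.*2 by lia.
  apply/existsP; exists (Ordinal ltd); rewrite !posE /= modnDml modn_mod.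
  by apply/eqP; congr (_ %% _); lia.
exists (F W) => [|[x i]]; first exact: hom_after_window.
have -> : i = pos (W + (W * m + i)).
  by apply: val_inj; rewrite /= posE addnA -mulnS modnMDl modn_small.
exact: (constant_after_window coreD linkF).
Qed.

(** * Uniquely colourable graphs of large girth *)

Theorem corollary1p3 (D : oriented_graph) (l : nat) (hD : is_core D) (hl : 0 < l) :
  exists Dstar : oriented_graph,
    girth_geq Dstar l /\ uniquely_colourable Dstar D.
Proof.
pose N := #|{ffun D -> D}|.*2; pose m := N * l.
exists (tensor D (circulant m N)); split.
  exact: girth_tensor_circulant.
split=> [|psi phi psiP phiP].
  exists fst; split=> [u v /andP[] //|y].
  by exists (y, ord0).
have [g gP phiE] := tensor_circulant_hom hD phiP.
have [g' g'P psiE] := tensor_circulant_hom hD psiP.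
have [k [gK _ kP]] := core_hom_inv hD gP.
exists (g' \o k); first by apply: hD => x y /kP/g'P.
by move=> u; rewrite /= phiE psiE gK.
Qed.
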